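(* Let $y\in\mathbb{R}^n$, $\lambda\ge 0$, and for $\tau\in(0,1)$ let $\mathcal{S}^{\tau}$ be the set of minimizers over $\theta\in\mathbb{R}^n$ of $\sum_{i=1}^{n}\rho_{\tau}(y_i-\theta_i)+\lambda\,TV(\theta)$. Let $\mathcal{I}$ be the set of all discrete subintervals of $[1:n]$. Fix $\tau\in(0,1)$ and a location $i\in[n]$, and let $\mathcal{S}^{\tau}_i:=\{\theta_i:\theta\in\mathcal{S}^{\tau}\}$. Then: (1) (Exact pointwise characterization) $\mathcal{S}^{\tau}_i$ is a compact interval in $\mathbb{R}$ given by $[L_i^{\tau},U_i^{\tau}]$, where $$L^{\tau}_i:=\max_{J\in\mathcal{I}:\,i\in J}\ \min_{I\in\mathcal{I}:\,I\subseteq J,\,i\in I}\ y_{I,(\lceil l^{\tau}_{I,J}\rceil)},\qquad U^{\tau}_i:=\min_{J\in\mathcal{I}:\,i\in J}\ \max_{I\in\mathcal{I}:\,I\subseteq J,\,i\in I}\ y_{I,(\lfloor u^{\tau}_{I,J}\rfloor+1)} .$$ (2) (Lattice property) $\mathcal{S}^{\tau}$ is closed under coordinatewise maximum and coordinatewise minimum. Consequently, there exist $\hat\theta^{Upper}\in\mathcal{S}^{\tau}$ and $\hat\theta^{Lower}\in\mathcal{S}^{\tau}$ such that $\hat\theta^{Upper}_j=U^{\tau}_j$ for all $j\in[n]$ and $\hat\theta^{Lower}_j=L^{\tau}_j$ for all $j\in[n]$. (3) (Non-crossing property) Let $0<\tau_1<\tau_2<1$ (with the same $y$ and $\lambda$).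 If $\hat\theta^{\tau_1}\in\mathcal{S}^{\tau_1}$ and $\hat\theta^{\tau_2}\in\mathcal{S}^{\tau_2}$, then $\hat\theta^{\tau_1}_j\le\hat\theta^{\tau_2}_j$ for every $j\in[n]$.
   Context: $[n]=\{1,\dots,n\}$; for integers $a\le b$, $[a:b]=\{a,\dots,b\}$ (a discrete interval, nonempty). $\rho_\tau(x)=\max\{\tau x,(\tau-1)x\}$ and $TV(\theta)=\sum_{k=1}^{n-1}|\theta_{k+1}-\theta_k|$. Order statistics convention: for a discrete interval $I\subseteq[1:n]$ and an integer $k$, $y_{I,(k)}$ is the $k$-th smallest element of $(y_j)_{j\in I}$ (counted with multiplicity) if $1\le k\le|I|$; $y_{I,(k)}=+\infty$ if $k\ge|I|+1$; $y_{I,(k)}=-\infty$ if $k\le0$. For $I\subseteq J$ in $\mathcal{I}$, $u^{\tau}_{I,J}:=\tau|I|-2\lambda C_{I,J}$ and $l^{\tau}_{I,J}:=\tau|I|+2\lambda C_{I,J}$, where $C_{I,J}$ is defined as follows. Write $J=[j_1:j_2]$, $I=[s:t]\subseteq J$; the notation $I\subset J$ means that $I$ contains neither $j_1$ nor $j_2$. - If $1<j_1\le j_2<n$: $C_{I,J}=1$ if $I\subset J$; $-1$ if $I=J$; $0$ otherwise. - If $1=j_1\le j_2<n$: $C_{I,J}=1$ if $I\subset J$; $-1/2$ if $I=J$; $1/2$ if $1=s\le t<j_2$; $0$ if $1<s\le t=j_2$. - If $1<j_1\le j_2=n$: $C_{I,J}=1$ if $I\subset J$; $-1/2$ if $I=J$;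 $1/2$ if $j_1<s\le t=n$; $0$ if $j_1=s\le t<n$. - If $J=[1:n]$: $C_{I,J}=1$ if $I\subset J$; $0$ if $I=J$; $1/2$ otherwise. *)

(* Defs.v *)
From HB Require Import structures.
From mathcomp Require Import all_boot all_order all_algebra.
From mathcomp Require Import all_classical all_reals all_analysis.

Set Implicit Arguments.
Unset Strict Implicit.
Unset Printing Implicit Defensive.

Import Order.TTheory GRing.Theory Num.Theory.
Import numFieldNormedType.Exports.

Local Open Scope ring_scope.

(* The position k of {1,...,n} is the ordinal k - 1 : 'I_n. Hence "1 < j" reads
   0 < j, and "j < n" reads j.+1 < n. *)

(* The nonempty discrete intervals [a:b] of {1,...,n}, given by their end
   points. *)
Definition dint (n : nat) : Type := {J : 'I_n * 'I_n | (J.1 <= J.2)%N}.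

Section DiscreteIntervals.
Variable n : nat.
Implicit Types I J : dint n.

Definition lo J : 'I_n := (val J).1.
Definition hi J : 'I_n := (val J).2.

Definition pts J : {set 'I_n} := [set k : 'I_n | (lo J <= k <= hi J)%N].

(* I is contained in J and contains neither end point of J: this is stronger
   than strict inclusion. *)
Definition inside I J : bool :=
  [&& pts I \subset pts J, lo J \notin pts I & hi J \notin pts I].

End DiscreteIntervals.

Section QuantileFusedLasso.
Variables (R : realType) (n : nat).
Implicit Types (y theta : 'rV[R]_n) (tau lambda : R) (I J : dint n).

Definition rho tau (x : R) : R := Num.max (tau * x) ((tau - 1) * x).

Definition TV theta : R :=
  \sum_(k < n) \sum_(l < n | l == k.+1 :> nat) `|theta 0 l - theta 0 k|.

Definition objective y lambda tau theta : R :=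
  \sum_(i < n) rho tau (y 0 i - theta 0 i) + lambda * TV theta.

Definition minimizers y lambda tau : set 'rV[R]_n :=
  [set theta | forall theta' : 'rV[R]_n,
     objective y lambda tau theta <= objective y lambda tau theta'].

(* Only meaningful when pts I \subset pts J; the end points of I = [s:t] and
   J = [j1:j2] then determine which case applies. *)
Definition Cst I J : R :=
  let j1 := lo J in let j2 := hi J in
  let s := lo I in let t := hi I in
  if (0 < j1)%N && (j2.+1 < n)%N then
    if inside I J then 1 else if I == J then -1 else 0
  else if (j2.+1 < n)%N then
    if inside I J then 1 else if I == J then - 2^-1
    else if (s == 0%N :> nat) && (t < j2)%N then 2^-1 else 0
  else if (0 < j1)%N then
    if inside I J then 1 else if I == J then - 2^-1
    else if (j1 < s)%N && (t.+1 == n) then 2^-1 else 0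
  else
    if inside I J then 1 else if I == J then 0 else 2^-1.

Definition upar lambda tau I J : R :=
  tau * #|pts I|%:R - 2 * lambda * Cst I J.

Definition lpar lambda tau I J : R :=
  tau * #|pts I|%:R + 2 * lambda * Cst I J.

Definition order_stat y I (k : int) : \bar R :=
  if k <= 0 then -oo%E
  else if #|pts I|%:Z < k then +oo%E
  else ((sort <=%O [seq y 0 j | j <- enum (pts I)])`_(`|k|%N.-1))%:E.

(* The index sets of the maxima and minima contain [i:i] and are never empty,
   so the neutral elements -oo and +oo do not affect the values. *)
Definition Lbound y lambda tau (i : 'I_n) : \bar R :=
  \big[maxe/-oo%E]_(J : dint n | i \in pts J)
    \big[mine/+oo%E]_(I : dint n | (pts I \subset pts J) && (i \in pts I))
      order_stat y I (Num.ceil (lpar lambda tau I J)).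

Definition Ubound y lambda tau (i : 'I_n) : \bar R :=
  \big[mine/+oo%E]_(J : dint n | i \in pts J)
    \big[maxe/-oo%E]_(I : dint n | (pts I \subset pts J) && (i \in pts I))
      order_stat y I (Num.floor (upar lambda tau I J) + 1).

Definition vmax theta theta' : 'rV[R]_n :=
  \row_j Num.max (theta 0 j) (theta' 0 j).

Definition vmin theta theta' : 'rV[R]_n :=
  \row_j Num.min (theta 0 j) (theta' 0 j).

End QuantileFusedLasso.

(* Main.v *)
(* Shifting a vector theta by a small e on an interval I changes the objective
   by at most e * (N - upar I J), where N counts the observations of I below the
   level theta_i, provided the ends of I are placed suitably with respect to J.

   If theta is a minimizer and J contains i, let I be the component containing i
   of the set of points of J where theta >= theta_i. Lowering theta on I does
   not decrease the objective, so #{j in I : y_j < theta_i} <= upar I J, which says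
   that theta_i is at most the order statistic of I in the definition of U_i.
   If theta is a maximal minimizer, let J be the component of i in
   {theta <= theta_i}. Raising theta on any I in J containing i strictly
   increases the objective, so #{j in I : y_j <= theta_i} > upar I J, and
   theta_i is at least the order statistic. Hence the maximal minimizer has coordinates
   U_i. The lower bound follows by the symmetry (y, tau, theta) ->
   (-y, 1 - tau, -theta), the interval in between by convexity.

   The lattice and non-crossing properties both follow from
   f_tau1(min) + f_tau2(max) <= f_tau1(theta1) + f_tau2(theta2) for
   tau1 <= tau2, with a gap (tau2 - tau1) * sum (theta1 - theta2)^+. *)

Require Import Defs.
From HB Require Import structures.
From mathcomp Require Import all_boot all_order all_algebra.
From mathcomp Require Import all_classical all_reals all_analysis.
From mathcomp Require Import zify ring lra.

Import Order.TTheory GRing.Theory Num.Theory.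
Import numFieldNormedType.Exports.

Local Open Scope classical_set_scope.
Local Open Scope ring_scope.

(** * Order statistics and counts of observations below a level *)

Section OrderStatistics.
Context {R : realType} {n : nat}.
Implicit Types (y : 'rV[R]_n) (I : dint n) (c : R).

Lemma count_enum_pts y I (p : pred R) :
  count p [seq y 0 j | j <- enum (pts I)] =
  (\sum_(j in pts I) p (y 0%R j))%N.
Proof.
by rewrite count_map -sum1_count big_enum_cond big_mkcondr /=;
  apply: eq_bigr => j _ /=; case: (p _).
Qed.

(** In a sorted list the entries below [c] come first, so the entry at index [k - 1] is at least [c]
    exactly when fewer than [k] entries are below [c]. The infinite values fit as well, since the
    count lies between 0 and [#|pts I|]. *)
Lemma order_stat_geP y I (k : int) c :
  (c%:E <= order_stat y I k)%E =
  ((\sum_(j in pts I) (y 0%R j < c)%R)%N%:Z < k).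
Proof.
rewrite /order_stat.
have Nle : (\sum_(j in pts I) (y 0%R j < c)%R <= #|pts I|)%N.
  by rewrite -sum1_card; apply: leq_sum => j _; case: (_ < _).
move: (\sum_(j in pts I) _)%N Nle (count_enum_pts y I (< c)) => N Nle cN.
case: ifP => [k0|/negbT k0]; first by
  rewrite leeNy_eq (_ : _ == _ = false) //; lia.
case: ifP => [k1|/negbT k1]; first by rewrite leey /=; lia.
rewrite lee_fin.
set s := sort _ _.
have ss : sorted <=%O s by apply: sort_sorted; apply: le_total.
have sz : size s = #|pts I| by rewrite size_sort size_map -cardE.
have {}cN : count (< c) s = N by rewrite -cN; apply/permP; rewrite perm_sort.
case: (ltnP `|k|.-1 (count (< c) s)) => h.
  have := nth_count_lt 0 ss h; rewrite ltNge => /negbTE ->; lia.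
have hh : (count (< c) s <= `|k|.-1 < size s)%N by lia.
rewrite (nth_count_ge 0 ss hh); lia.
Qed.

Lemma order_stat_leP y I (k : int) c :
  (order_stat y I k <= c%:E)%E =
  (k <= (\sum_(j in pts I) (y 0%R j <= c)%R)%N%:Z).
Proof.
rewrite /order_stat.
have Nle : (\sum_(j in pts I) (y 0%R j <= c)%R <= #|pts I|)%N.
  by rewrite -sum1_card; apply: leq_sum => j _; case: (_ <= _).
move: (\sum_(j in pts I) _)%N Nle (count_enum_pts y I (<= c)) => N Nle cN.
case: ifP => [k0|/negbT k0]; first by rewrite leNye /=; lia.
case: ifP => [k1|/negbT k1]; first by
  rewrite leye_eq (_ : _ == _ = false) //; lia.
rewrite lee_fin.
set s := sort _ _.
have ss : sorted <=%O s by apply: sort_sorted; apply: le_total.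
have sz : size s = #|pts I| by rewrite size_sort size_map -cardE.
have {}cN : count (<= c) s = N by rewrite -cN; apply/permP; rewrite perm_sort.
case: (ltnP `|k|.-1 (count (<= c) s)) => h.
  rewrite (nth_count_le 0 ss h); lia.
have hh : (count (<= c)%O s <= `|k|.-1 < size s)%N by lia.
have := nth_count_gt 0 ss hh; rewrite ltNge => /negbTE ->; lia.
Qed.

End OrderStatistics.

(** * Discrete intervals, components and the boundary signs behind [Cst] *)

Section IntervalComponents.
Context {n : nat}.
Implicit Types (I J : dint n) (i k : 'I_n).

Lemma in_pts J k : (k \in pts J) = (lo J <= k <= hi J)%N.
Proof. by rewrite inE. Qed.

Lemma lo_le_hi J : (lo J <= hi J)%N.
Proof. exact: (valP J). Qed.

Lemma pts_subset I J :
  (pts I \subset pts J) = (lo J <= lo I)%N && (hi I <= hi J)%N.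
Proof.
apply/fintype.subsetP/andP => [sIJ|[h1 h2] k]; last by rewrite !in_pts; lia.
have := sIJ (lo I); have := sIJ (hi I); have := lo_le_hi I.
rewrite !in_pts; lia.
Qed.

Lemma dint_eq I J :
  (I == J) = ((lo I : nat) == lo J) && ((hi I : nat) == hi J).
Proof. by rewrite -val_eqE /= -pair_eqE /= /pair_eq. Qed.

(** The ends are the least [s] and the greatest [t] such that [P] holds on [[s:i]] and on [[i:t]].
    The last two clauses express maximality and are vacuous at the ends of [[1:n]]. *)
Lemma component (P : pred 'I_n) i : P i ->
  exists I, [/\ i \in pts I, {in pts I, forall k, P k},
    (forall k, k.+1 = lo I -> ~~ P k) & (forall k, (hi I).+1 = k -> ~~ P k)].
Proof.
move=> Pi.
pose A s := [exists l : 'I_n, (l == s :> nat) && (s <= i)%N &&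
  [forall k : 'I_n, (s <= k <= i)%N ==> P k]].
pose B t := [exists l : 'I_n, (l == t :> nat) && (i <= t)%N &&
  [forall k : 'I_n, (i <= k <= t)%N ==> P k]].
have Ai : exists s, A s.
  exists i; apply/existsP; exists i; rewrite eqxx leqnn /=.
  apply/forallP => k; apply/implyP => h.
  by have -> : k = i by apply: val_inj => /=; lia.
have Bi : exists t, B t.
  exists i; apply/existsP; exists i; rewrite eqxx leqnn /=.
  apply/forallP => k; apply/implyP => h.
  by have -> : k = i by apply: val_inj => /=; lia.
have Bn t : B t -> (t <= n)%N.
  by move=> /existsP[l /andP[/andP[/eqP <- _] _]]; apply/ltnW.
case: (ex_minnP Ai) => s /existsP[l /andP[/andP[/eqP ls si] /forallP Ps]] mins.
case: (ex_maxnP Bi Bn) => t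
  /existsP[r /andP[/andP[/eqP rt it] /forallP Pt]] maxt.
have lr : (l <= r)%N by lia.
exists (exist _ (l, r) lr); rewrite /lo /hi /=; split.
- by rewrite in_pts /lo /hi /=; lia.
- move=> k; rewrite in_pts /lo /hi /= => /andP[lk kr].
  case: (leqP k i) => ki; first by apply: (implyP (Ps k)); lia.
  by apply: (implyP (Pt k)); lia.
- move=> k kl; apply/negP => Pk.
  suff /mins : A k by lia.
  apply/existsP; exists k; rewrite eqxx /=; apply/andP; split; first by lia.
  apply/forallP => j; apply/implyP => h.
  case: (eqVneq j k) => [->//|jk]; apply: (implyP (Ps j)).
  by move: jk; rewrite -val_eqE /=; lia.
- move=> k kl; apply/negP => Pk.
  suff /maxt : B k by lia.
  apply/existsP; exists k; rewrite eqxx /=; apply/andP; split; first by lia.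
  apply/forallP => j; apply/implyP => h.
  case: (eqVneq j k) => [->//|jk]; apply: (implyP (Pt j)).
  by move: jk; rewrite -val_eqE /=; lia.
Qed.

(* [2 * Cst] is the change of perimeter when I is switched on, J being off
   and its complement on: an end of I inside [1:n] counts -1 if it is also an
   end of J, and +1 otherwise. *)
Definition left_sign {R : realType} I J : R :=
  if (0 < lo I)%N then if lo I == lo J then -1 else 1 else 0.

Definition right_sign {R : realType} I J : R :=
  if ((hi I).+1 < n)%N then if hi I == hi J then -1 else 1 else 0.

Lemma CstE (R : realType) I J : pts I \subset pts J ->
  2 * Cst R I J = left_sign I J + right_sign I J.
Proof.
rewrite pts_subset => /andP[h1 h2].
have := lo_le_hi I; have := ltn_ord (hi J); have := ltn_ord (hi I) => a b c.
have b1 : ((lo I : nat) == lo J) && ((hi I : nat) == hi J) =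
  (((lo I : nat) <= lo J)%N && (hi J <= hi I)%N) by lia.
rewrite /Cst /left_sign /right_sign dint_eq /inside pts_subset !in_pts.
rewrite -!val_eqE /= h1 h2 /=.
have [?|?] := ltnP 0 (lo J); have [?|?] := ltnP (hi J).+1 n;
have [?|?] := ltnP (lo J) (lo I); have [?|?] := ltnP (hi I) (hi J);
have [?|?] := ltnP 0 (lo I); have [?|?] := ltnP (hi I).+1 n; try lia;
rewrite /=; repeat case: ifP; move=> *; try lra; lia.
Qed.

End IntervalComponents.

(** * First-order effect of shifting a vector on an interval *)

Section Perturbation.
Context {R : realType} {n : nat}.
Variables (y : 'rV[R]_n) (lambda : R).
Hypothesis lambda_ge0 : 0 <= lambda.
Implicit Types (theta : 'rV[R]_n) (tau e : R) (I J : dint n) (i : 'I_n).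

(** Supplies a step that passes none of finitely many positive gaps; the default 1 covers the case
    where no value is positive. *)
Lemma finite_lower_bound (T : finType) (f : T -> R) :
  exists2 d, 0 < d & forall t, 0 < f t -> d <= f t.
Proof.
exists (\big[Num.min/1]_(t | 0 < f t) f t); last first.
  by move=> t ft; apply: bigmin_le_cond.
by elim/big_ind: _ => // a b a0 b0; rewrite lt_min a0.
Qed.

(** Writes a boundary term as a sum over the edges of [TV], so that [TV_shift] can be checked edge
    by edge. *)
Lemma sum_left_end I (a : R) :
  \sum_(k < n) \sum_(l < n | l == k.+1 :> nat) (if l == lo I then a else 0) =
  if (0 < lo I)%N then a else 0.
Proof.
rewrite (exchange_big_dep predT) //= (bigD1 (lo I)) //= eqxx.
rewrite [X in _ + X]big1 ?addr0 => [|l /negbTE ll]; last first.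
  by rewrite ll big1.
case: ifP => [l0|l0].
  have kn : ((lo I).-1 < n)%N by have := ltn_ord (lo I); lia.
  rewrite (big_pred1 (Ordinal kn)) // => k /=; rewrite -val_eqE /=; lia.
by rewrite big_pred0 // => k; lia.
Qed.

Lemma sum_right_end I (a : R) :
  \sum_(k < n) \sum_(l < n | l == k.+1 :> nat) (if k == hi I then a else 0) =
  if ((hi I).+1 < n)%N then a else 0.
Proof.
rewrite (bigD1 (hi I)) //= eqxx.
rewrite [X in _ + X]big1 ?addr0 => [|l /negbTE ll]; last first.
  by rewrite ll big1.
case: ifP => [l0|l0].
  by rewrite (big_pred1 (Ordinal l0)) // => k /=; rewrite -val_eqE.
by rewrite big_pred0 // => k; have := ltn_ord k; lia.
Qed.

Definition shift theta I e : 'rV[R]_n :=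
  \row_j (theta 0 j + (if j \in pts I then e else 0)).

(** Only the edges leaving [I] change, and the two hypotheses bound their change by [e] times the
    signs that add up to [2 * Cst R I J]. The sign of [e] is free, so raising and lowering are both
    covered. *)
Lemma TV_shift theta I J e : pts I \subset pts J ->
  (forall k : 'I_n, k.+1 = lo I :> nat ->
     `|theta 0 (lo I) + e - theta 0 k| <=
     `|theta 0 (lo I) - theta 0 k| + e * (if lo I == lo J then -1 else 1)) ->
  (forall k : 'I_n, (hi I).+1 = k ->
     `|theta 0 (hi I) + e - theta 0 k| <=
     `|theta 0 (hi I) - theta 0 k| + e * (if hi I == hi J then -1 else 1)) ->
  TV (shift theta I e) <= TV theta + e * (2 * Cst R I J).
Proof.
move=> IJ hl hr; rewrite CstE //.
pose a : R := if lo I == lo J then -1 else 1.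
pose b : R := if hi I == hi J then -1 else 1.
have -> : left_sign I J + right_sign I J =
   \sum_(k < n) \sum_(l < n | l == k.+1 :> nat)
    ((if l == lo I then a else 0) + (if k == hi I then b else 0)).
  rewrite -[left_sign I J](sum_left_end I a)
    -[right_sign I J](sum_right_end I b).
  by rewrite -big_split; apply: eq_bigr => k _; rewrite -big_split.
rewrite mulr_sumr -big_split; apply: ler_sum => k _ /=.
rewrite mulr_sumr -big_split; apply: ler_sum => l /eqP lk /=.
have llh := lo_le_hi I.
rewrite !mxE; have [lI|lI] := eqVneq l (lo I).
  have kl : k.+1 = lo I by rewrite -lI lk.
  have -> : l \in pts I by rewrite lI in_pts leqnn llh.
  have -> : (k \in pts I) = false by rewrite in_pts; lia.
  have -> : (k == hi I) = false by apply/negbTE; rewrite -val_eqE /=; lia.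
  by rewrite !addr0 lI; apply: hl.
have [kI|kI] := eqVneq k (hi I).
  have kl : (hi I).+1 = l by rewrite -kI lk.
  have -> : k \in pts I by rewrite kI in_pts leqnn llh.
  have -> : (l \in pts I) = false by rewrite in_pts; lia.
  rewrite addr0 add0r distrC [in leRHS]distrC kI; exact: hr.
(* Any other edge has both ends in [I] or both outside, so its difference is unchanged. *)
have -> : (l \in pts I) = (k \in pts I).
  by move: lI kI; rewrite !in_pts -!val_eqE /=; lia.
by rewrite addr0 mulr0 addr0 opprD addrACA subrr addr0.
Qed.

(** A point of [I] contributes [e * (b j - tau)] and the boundary [e * (2 * lambda * Cst R I J)];
    together they give the count minus [upar]. The predicate [b] is left open because lowering needs
    a strict comparison and raising a weak one. *)
Lemma objective_shift tau theta I J e (b : 'I_n -> bool) :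
  pts I \subset pts J ->
  (forall k : 'I_n, k.+1 = lo I :> nat ->
     `|theta 0 (lo I) + e - theta 0 k| <=
     `|theta 0 (lo I) - theta 0 k| + e * (if lo I == lo J then -1 else 1)) ->
  (forall k : 'I_n, (hi I).+1 = k ->
     `|theta 0 (hi I) + e - theta 0 k| <=
     `|theta 0 (hi I) - theta 0 k| + e * (if hi I == hi J then -1 else 1)) ->
  {in pts I, forall j, rho tau (y 0 j - theta 0 j - e) <=
     rho tau (y 0 j - theta 0 j) + e * ((b j)%:R - tau)} ->
  objective y lambda tau (shift theta I e) <=
  objective y lambda tau theta +
  e * ((\sum_(j in pts I) b j)%N%:R - upar lambda tau I J).
Proof.
move=> IJ hl hr hd.
have hTV := TV_shift theta I J e IJ hl hr.
have -> : (\sum_(j in pts I) b j)%N%:R - upar lambda tau I J =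
   \sum_j (if j \in pts I then ((b j)%:R - tau) else 0) + lambda * (2 * Cst R I J).
  rewrite -big_mkcond sumrB /= sumr_const -natr_sum /upar -mulr_natr; lra.
rewrite /objective mulrDr addrACA lerD //; last first.
  by rewrite mulrCA -mulrDr ler_wpM2l.
rewrite mulr_sumr -big_split; apply: ler_sum => j _ /=; rewrite mxE.
case: ifP => [jI|_]; last by rewrite addr0 mulr0 addr0.
by rewrite opprD addrA hd.
Qed.

(** [rho] has slope [tau - 1] left of 0 and [tau] right of it, and the step must not cross 0. The
    slope at the kink depends on the direction, hence [x < 0] here and [x <= 0] in
    [rho_left_slope]. *)
Lemma rho_right_slope tau (x e : R) : 0 < e -> (x < 0 -> e <= - x) ->
  rho tau (x + e) <= rho tau x - e * ((x < 0)%R%:R - tau).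
Proof.
move=> e0; case: (ltrP x 0) => x0 h /=; first have {}h := h isT;
  rewrite /rho !maxEle; do 2 case: ifP => // *; lra.
Qed.

Lemma rho_left_slope tau (x e : R) : 0 < e -> (0 < x -> e <= x) ->
  rho tau (x - e) <= rho tau x + e * ((x <= 0)%R%:R - tau).
Proof.
move=> e0; case: (lerP x 0) => x0 h /=; last have {}h := h isT;
  rewrite /rho !maxEle; do 2 case: ifP => // *; lra.
Qed.

Lemma minimizer_count_le tau theta i J : i \in pts J ->
  minimizers y lambda tau theta ->
  exists I, [/\ pts I \subset pts J, i \in pts I &
    (\sum_(j in pts I) (y 0%R j < theta 0%R i)%R)%N%:R <= upar lambda tau I J].
Proof.
move=> iJ mt.
have [I [iI PI lI hI]] :=
  component (fun k => (k \in pts J) && (theta 0 i <= theta 0 k)) i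
    (introT andP (conj iJ (lexx _))).
have IJ : pts I \subset pts J.
  by apply/fintype.subsetP => k /PI /andP[].
exists I; split => //.
(* With [e] at most every positive gap between coordinates and every positive [theta_j - y_j],
   lowering by [e] overtakes neither a neighbour nor an observation. *)
have [d d0 hd] := finite_lower_bound ('I_n * 'I_n)%type
  (fun p => theta 0 p.1 - theta 0 p.2).
have [d' d'0 hd'] := finite_lower_bound 'I_n (fun j => theta 0 j - y 0 j).
pose e := Num.min d d'.
have e0 : 0 < e by rewrite lt_min d0.
have ed : e <= d by rewrite ge_min lexx.
have ed' : e <= d' by rewrite ge_min lexx orbT.
have loI : lo I \in pts I by rewrite in_pts leqnn lo_le_hi.
have hiI : hi I \in pts I by rewrite in_pts leqnn lo_le_hi.
have gap k l : theta 0 l < theta 0 k ->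
   `|theta 0 k - e - theta 0 l| <= `|theta 0 k - theta 0 l| - e.
  move=> lk; have := hd (k, l); rewrite /= subr_gt0 => /(_ lk) h.
  by rewrite !ger0_norm; lra.
have tri k l : `|theta 0 k - e - theta 0 l| <= `|theta 0 k - theta 0 l| + e.
  rewrite addrAC (le_trans (ler_normB _ _)) // (gtr0_norm e0) //.
have H := objective_shift tau theta I J (- e) (fun j => y 0 j < theta 0 i) IJ.
suff : objective y lambda tau (shift theta I (- e)) <=
    objective y lambda tau theta + - e *
     ((\sum_(j in pts I) (y 0%R j < theta 0%R i)%R)%N%:R - upar lambda tau I J).
  move=> h; have := le_trans (mt _) h.
  by rewrite lerDl mulNr oppr_ge0 pmulr_rle0 // subr_le0.
apply: H => [k kl|k kl|j jI].
(* At an end shared with [J] the triangle inequality suffices. At any other end the neighbour lies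
   in [J] but outside the component, hence below [theta_i], and the edge shrinks by [e]. *)
- case: eqP => [_|/eqP ne]; first by have := tri (lo I) k; lra.
  have := gap (lo I) k; rewrite mulr1; apply.
  have := lI k kl; rewrite negb_and.
  have -> /= : k \in pts J.
    move: IJ; rewrite pts_subset in_pts.
    by move: ne; rewrite -val_eqE /=; have := lo_le_hi I; lia.
  by rewrite -ltNge => /lt_le_trans; apply; have /andP[] := PI _ loI.
- case: eqP => [_|/eqP ne]; first by have := tri (hi I) k; lra.
  have := gap (hi I) k; rewrite mulr1; apply.
  have := hI k kl; rewrite negb_and.
  have -> /= : k \in pts J.
    move: IJ; rewrite pts_subset in_pts.
    by move: ne; rewrite -val_eqE /=; have := lo_le_hi I; lia.
  by rewrite -ltNge => /lt_le_trans; apply; have /andP[] := PI _ hiI.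
- have /andP[_ cj] := PI _ jI.
  have h := hd' j.
  rewrite opprK; apply: (@le_trans _ _ (rho tau (y 0 j - theta 0 j) -
      e * ((y 0 j - theta 0 j < 0)%R%:R - tau))).
    apply: rho_right_slope => // xy; rewrite opprB; apply: (le_trans ed').
    by apply: h; lra.
  (* Since [theta_i <= theta_j] on [I], [y_j < theta_i] forces [y_j < theta_j]. *)
  rewrite mulNr lerD2l lerN2 ler_wpM2l ?(ltW e0) // lerD2r subr_lt0.
  by rewrite ler_nat; case: (ltrP (y 0 j) (theta 0 i)) => // yi;
    rewrite (lt_le_trans yi cj).
Qed.

Lemma maximal_minimizer_count_gt tau theta i :
  minimizers y lambda tau theta ->
  (forall theta', minimizers y lambda tau theta' ->
     (forall j, theta 0 j <= theta' 0 j) -> theta' = theta) ->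
  exists J, i \in pts J /\
  forall I, pts I \subset pts J -> i \in pts I ->
    upar lambda tau I J < (\sum_(j in pts I) (y 0%R j <= theta 0%R i)%R)%N%:R.
Proof.
move=> mt maxt.
have [J [iJ PJ lJ hJ]] :=
  component (fun k => (theta 0 k <= theta 0 i)) i (lexx _).
exists J; split => // I IJ iI.
have [d d0 hd] := finite_lower_bound ('I_n * 'I_n)%type
  (fun p => theta 0 p.1 - theta 0 p.2).
have [d' d'0 hd'] := finite_lower_bound 'I_n (fun j => y 0 j - theta 0 j).
pose e := Num.min d d'.
have e0 : 0 < e by rewrite lt_min d0.
have ed : e <= d by rewrite ge_min lexx.
have ed' : e <= d' by rewrite ge_min lexx orbT.
have loI : lo I \in pts I by rewrite in_pts leqnn lo_le_hi.
have hiI : hi I \in pts I by rewrite in_pts leqnn lo_le_hi.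
have PI j : j \in pts I -> theta 0 j <= theta 0 i.
  by move=> jI; apply/PJ/(fintype.subsetP IJ).
have gap k l : theta 0 k < theta 0 l ->
   `|theta 0 k + e - theta 0 l| <= `|theta 0 k - theta 0 l| - e.
  move=> lk; have := hd (l, k); rewrite /= subr_gt0 => /(_ lk) h.
  by rewrite !ler0_norm; lra.
have tri k l : `|theta 0 k + e - theta 0 l| <= `|theta 0 k - theta 0 l| + e.
  by rewrite addrAC (le_trans (ler_normD _ _)) // (gtr0_norm e0).
have H := objective_shift tau theta I J e (fun j => y 0 j <= theta 0 i) IJ.
(* If the count were at most [upar], the raised vector would again be a minimizer, strictly larger
   at [i], against maximality. *)
rewrite ltNge; apply/negP => hN.
suff : objective y lambda tau (shift theta I e) <=
    objective y lambda tau theta + e *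
     ((\sum_(j in pts I) (y 0%R j <= theta 0%R i)%R)%N%:R - upar lambda tau I J).
  move=> h.
  have ms : minimizers y lambda tau (shift theta I e).
    move=> t; apply: (le_trans h); apply: le_trans (mt t).
    by rewrite gerDl pmulr_rle0 // subr_le0.
  have /rowP /(_ i) : shift theta I e = theta.
    apply: maxt => // j; rewrite mxE lerDl; case: ifP => // _; exact: ltW.
  by rewrite mxE iI; lra.
apply: H => [k kl|k kl|j jI].
(* The neighbour beyond an end of [J] lies above [theta_i], so an edge at a shared end shrinks; the
   triangle inequality handles the other ends. *)
- case: eqP => [E|/eqP ne]; last by have := tri (lo I) k; lra.
  have := gap (lo I) k; rewrite mulrN1; apply.
  have := lJ k; rewrite -E => /(_ kl).
  by rewrite -ltNge; apply: le_lt_trans; apply: PI.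
- case: eqP => [E|/eqP ne]; last by have := tri (hi I) k; lra.
  have := gap (hi I) k; rewrite mulrN1; apply.
  have := hJ k; rewrite -E => /(_ kl).
  by rewrite -ltNge; apply: le_lt_trans; apply: PI.
- have cj := PI _ jI.
  have h := hd' j.
  apply: (@le_trans _ _ (rho tau (y 0 j - theta 0 j) +
      e * ((y 0 j - theta 0 j <= 0)%R%:R - tau))).
    apply: rho_left_slope => // xy; apply: (le_trans ed').
    by apply: h; lra.
  rewrite lerD2l ler_wpM2l ?(ltW e0) // lerD2r subr_le0.
  by rewrite ler_nat; case: (lerP (y 0 j) (theta 0 j)) => // yj;
    rewrite (le_trans yj cj).
Qed.

End Perturbation.

(** * Submodularity, convexity and reflection of the objective *)

Section Submodularity.
Context {R : realType} {n : nat}.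
Variables (y : 'rV[R]_n) (lambda : R).
Hypothesis lambda_ge0 : 0 <= lambda.
Implicit Types (theta : 'rV[R]_n) (tau : R) (i j : 'I_n).

(** Holds edge by edge: both sides agree when the vectors are ordered alike at the two ends, and
    only a crossing needs an estimate. *)
Lemma TV_submodular theta1 theta2 :
  TV (vmin theta1 theta2) + TV (vmax theta1 theta2) <= TV theta1 + TV theta2.
Proof.
rewrite /TV -!big_split; apply: ler_sum => k _ /=.
rewrite -!big_split; apply: ler_sum => l _ /=; rewrite !mxE.
move: (theta1 0 k) (theta1 0 l) (theta2 0 k) (theta2 0 l) => a b c d.
case: (lerP a c) => ac; case: (lerP b d) => bd; rewrite // ?(addrC `|d - c|) //.
- have := ler_norm (b - a); have := ler_norm (d - c).
  have := lerNnormlW (lexx `|b - a|); have := lerNnormlW (lexx `|d - c|).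
  case: (ger0P (d - a)) => h1; case: (ger0P (b - c)) => h2; lra.
- have := ler_norm (b - a); have := ler_norm (d - c).
  have := lerNnormlW (lexx `|b - a|); have := lerNnormlW (lexx `|d - c|).
  case: (ger0P (d - a)) => h1; case: (ger0P (b - c)) => h2; lra.
Qed.

(** In [tau * z + max 0 (- z)] the second term does not involve [tau], so min and max merely permute
    it; the linear term produces the gap. *)
Lemma rho_submodular tau1 tau2 (x a b : R) : tau1 <= tau2 ->
  rho tau1 (x - Num.min a b) + rho tau2 (x - Num.max a b) <=
  rho tau1 (x - a) + rho tau2 (x - b) - (tau2 - tau1) * (Num.max a b - b).
Proof.
have rhoE t z : rho t z = t * z + Num.max 0 (- z).
  by rewrite /rho addr_maxr addr0 mulrBl mul1r.
by move=> tt; rewrite !rhoE; case: (lerP a b) => ab; lra.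
Qed.

Lemma objective_submodular tau1 tau2 theta1 theta2 : tau1 <= tau2 ->
  objective y lambda tau1 (vmin theta1 theta2) +
  objective y lambda tau2 (vmax theta1 theta2) <=
  objective y lambda tau1 theta1 + objective y lambda tau2 theta2 -
  (tau2 - tau1) * \sum_i (Num.max (theta1 0 i) (theta2 0 i) - theta2 0 i).
Proof.
move=> tt; have hTV := ler_wpM2l lambda_ge0 (TV_submodular theta1 theta2).
rewrite /objective.
have : \sum_i (rho tau1 (y 0 i - vmin theta1 theta2 0 i) +
               rho tau2 (y 0 i - vmax theta1 theta2 0 i)) <=
       \sum_i (rho tau1 (y 0 i - theta1 0 i) + rho tau2 (y 0 i - theta2 0 i) -
         (tau2 - tau1) * (Num.max (theta1 0 i) (theta2 0 i) - theta2 0 i)).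
  by apply: ler_sum => i _; rewrite !mxE; apply: rho_submodular.
rewrite sumrB -mulr_sumr !big_split /=; lra.
Qed.

(** The two new values add up to at most twice the minimum, and neither is below it. *)
Lemma minimizers_lattice tau theta1 theta2 :
  minimizers y lambda tau theta1 -> minimizers y lambda tau theta2 ->
  minimizers y lambda tau (vmax theta1 theta2) /\
  minimizers y lambda tau (vmin theta1 theta2).
Proof.
move=> m1 m2; have := objective_submodular tau tau theta1 theta2 (lexx _).
rewrite subrr mul0r subr0 => h.
have := m1 (vmin theta1 theta2); have := m2 (vmax theta1 theta2) => h2 h1.
by split=> t; have := m1 t; have := m2 t; lra.
Qed.

Lemma minimizers_noncrossing tau1 tau2 theta1 theta2 : tau1 < tau2 ->
  minimizers y lambda tau1 theta1 -> minimizers y lambda tau2 theta2 ->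
  forall i, theta1 0 i <= theta2 0 i.
Proof.
move=> tt m1 m2 i; have := objective_submodular tau1 tau2 theta1 theta2 (ltW tt).
have := m1 (vmin theta1 theta2); have := m2 (vmax theta1 theta2) => h2 h1 h.
pose g j := Num.max (theta1 0 j) (theta2 0 j) - theta2 0 j.
have g0 j : 0 <= g j by rewrite subr_ge0 le_max lexx orbT.
(* By optimality of both vectors the gap is nonpositive, so every nonnegative term [g j]
   vanishes. *)
have : (tau2 - tau1) * \sum_j g j <= 0 by rewrite /g; lra.
rewrite pmulr_rle0 ?subr_gt0 // => sg.
have : g i <= 0.
  by apply: le_trans sg; rewrite (bigD1 i) //= lerDl sumr_ge0.
by rewrite /g subr_le0 ge_max => /andP[].
Qed.

Lemma rho_convex tau (s a b : R) : 0 <= s <= 1 ->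
  rho tau (s * a + (1 - s) * b) <= s * rho tau a + (1 - s) * rho tau b.
Proof.
move=> /andP[s0 s1].
have [h1 h2] : tau * a <= rho tau a /\ (tau - 1) * a <= rho tau a.
  by split; rewrite /rho le_max lexx ?orbT.
have [h3 h4] : tau * b <= rho tau b /\ (tau - 1) * b <= rho tau b.
  by split; rewrite /rho le_max lexx ?orbT.
have t0 : 0 <= 1 - s by rewrite subr_ge0.
have g1 := ler_wpM2l s0 h1; have g2 := ler_wpM2l s0 h2.
have g3 := ler_wpM2l t0 h3; have g4 := ler_wpM2l t0 h4.
by rewrite [leLHS]/rho ge_max; apply/andP; split; lra.
Qed.

Lemma objective_convex tau (s : R) theta1 theta2 : 0 <= s <= 1 ->
  objective y lambda tau (s *: theta1 + (1 - s) *: theta2) <=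
  s * objective y lambda tau theta1 + (1 - s) * objective y lambda tau theta2.
Proof.
move=> s01; have /andP[s0 s1] := s01.
rewrite /objective !mulrDr addrACA lerD //.
  rewrite !mulr_sumr -big_split; apply: ler_sum => i _ /=; rewrite !mxE.
  have := rho_convex tau s (y 0 i - theta1 0 i) (y 0 i - theta2 0 i) s01.
  by apply: le_trans; rewrite le_eqVlt; apply/orP; left; apply/eqP;
    congr rho; lra.
rewrite mulrCA [_ * (lambda * _)]mulrCA -mulrDr ler_wpM2l //.
rewrite /TV !mulr_sumr -big_split; apply: ler_sum => k _ /=.
rewrite !mulr_sumr -big_split; apply: ler_sum => l _ /=; rewrite !mxE.
have -> : s * theta1 0 l + (1 - s) * theta2 0 l -
   (s * theta1 0 k + (1 - s) * theta2 0 k) =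
   s * (theta1 0 l - theta1 0 k) + (1 - s) * (theta2 0 l - theta2 0 k) by lra.
by rewrite (le_trans (ler_normD _ _)) // !normrM (ger0_norm s0)
  (@ger0_norm _ (1 - s)) ?subr_ge0.
Qed.

Lemma objectiveN tau theta :
  objective (- y) lambda (1 - tau) (- theta) = objective y lambda tau theta.
Proof.
rewrite /objective; congr (_ + _ * _).
  apply: eq_bigr => i _; rewrite !mxE /rho maxC; congr Num.max; lra.
apply: eq_bigr => k _; apply: eq_bigr => l _; rewrite !mxE.
by rewrite -opprD normrN.
Qed.

End Submodularity.

Lemma minimizersN {R : realType} {n : nat} (y : 'rV[R]_n) lambda tau theta :
  minimizers (- y) lambda (1 - tau) (- theta) <-> minimizers y lambda tau theta.
Proof.
split=> m t; first by have := m (- t); rewrite !objectiveN.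
by rewrite -[t]opprK !objectiveN; apply: m.
Qed.

(** * Existence of a maximal minimizer *)

Section Existence.
Context {R : realType} {n : nat}.
Variables (y : 'rV[R]_n) (lambda tau : R).
Hypothesis lambda_ge0 : 0 <= lambda.
Hypothesis tau01 : 0 < tau < 1.

Lemma sum_continuous (T : topologicalType) (I : Type) (r : seq I) (P : pred I)
    (F : I -> T -> R) : (forall i, continuous (F i)) ->
  continuous (fun x => \sum_(i <- r | P i) F i x).
Proof.
by move=> cF; apply: continuous_big => // x; exact: add_continuous.
Qed.

Lemma objective_continuous :
  continuous (objective y lambda tau : 'rV[R]_n -> R).
Proof.
have cc (j : 'I_n) : continuous (fun t : 'rV[R]_n => t 0 j).
  exact: coord_continuous.
have cr (a : R) (j : 'I_n) :
    continuous (fun t : 'rV[R]_n => a * (y 0 j - t 0 j)).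
  move=> t; apply: (continuousM (@cst_continuous _ _ a t)).
  exact: (continuousB (@cst_continuous _ _ (y 0 j) t) (cc j t)).
have cTV : continuous (@TV R n).
  apply: sum_continuous => k; apply: sum_continuous => l t.
  apply: (continuous_comp (continuousB (cc l t) (cc k t))).
  exact: norm_continuous.
have cD : continuous (fun t : 'rV[R]_n => \sum_j rho tau (y 0 j - t 0 j)).
  apply: sum_continuous => j.
  exact: (max_fun_continuous (cr tau j) (cr (tau - 1) j)).
move=> t; apply: (continuousD (cD t)).
exact: (continuousM (@cst_continuous _ _ lambda t) (cTV t)).
Qed.

Lemma rho_coercive (z : R) : Num.min tau (1 - tau) * `|z| <= rho tau z.
Proof.
have /andP[t0 t1] := tau01.
rewrite /rho le_max; case: (ger0P z) => z0; apply/orP; [left|right].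
  by rewrite ler_wpM2r // ge_min lexx.
by rewrite mulrN lerNl -mulNr ler_wnM2r ?(ltW z0) // opprB ge_min lexx orbT.
Qed.

(** The set is closed and lies in a box: all terms of the objective are nonnegative, so each [rho]
    term is at most [a], and coercivity keeps [theta_j] within [M] of [y_j]. *)
Lemma sublevel_compact (a : R) :
  compact [set theta : 'rV[R]_n | objective y lambda tau theta <= a].
Proof.
have m0 : 0 < Num.min tau (1 - tau).
  by have /andP[t0 t1] := tau01; rewrite lt_min t0 subr_gt0.
have rho0 z : 0 <= rho tau z.
  by apply: le_trans (rho_coercive z); rewrite mulr_ge0 // ltW.
pose M := a / Num.min tau (1 - tau).
apply: (@subclosed_compact _ _
  [set t : 'rV[R]_n | forall j, `[y 0 j - M, y 0 j + M]%classic (t ord0 j)]).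
- apply: (@preimage_closed _ _ _ [set x | x <= a]); last exact: closed_le.
  by move=> t _; exact: objective_continuous.
- apply: (@rV_compact _ _ (fun j => `[y 0 j - M, y 0 j + M]%classic)) => j.
  exact: segment_compact.
move=> t /= ta j.
have h : rho tau (y 0 j - t 0 j) <= a.
  apply: le_trans ta; rewrite /objective (bigD1 j) //= -addrA lerDl.
  rewrite addr_ge0 ?sumr_ge0 // mulr_ge0 // /TV sumr_ge0 // => k _.
  by rewrite sumr_ge0.
have : `|y 0 j - t 0 j| <= M.
  by rewrite ler_pdivlMr // mulrC (le_trans _ h) // rho_coercive.
by rewrite ler_norml in_itv /= => /andP[h1 h2]; apply/andP; split; lra.
Qed.

(** A minimizer with the largest coordinate sum has no other minimizer above it. *)
Lemma exists_maximal_minimizer : exists2 theta, minimizers y lambda tau theta &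
  forall theta', minimizers y lambda tau theta' ->
    (forall j, theta 0 j <= theta' 0 j) -> theta' = theta.
Proof.
have cO (f : 'rV[R]_n -> R) A : continuous f -> {within A, continuous f}.
  by move=> cf; apply: continuous_subspaceT.
have [t0 _ ht0] := EVT_min_rV (ex_intro _ y (lexx _))
  (sublevel_compact (objective y lambda tau y)) (cO _ _ objective_continuous).
have m0 : minimizers y lambda tau t0.
  move=> t.
  case: (lerP (objective y lambda tau t) (objective y lambda tau y)) => h.
    by apply: ht0; rewrite inE.
  by apply: le_trans (ltW h); apply: ht0; rewrite inE /=.
have cs : continuous (fun t : 'rV[R]_n => \sum_j t 0 j).
  by apply: sum_continuous => j; exact: coord_continuous.
(* The sublevel set at the minimal value consists exactly of the minimizers. *)
have [t] := EVT_max_rV (ex_intro _ t0 (lexx _))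
  (sublevel_compact (objective y lambda tau t0)) (cO _ _ cs).
rewrite inE /= => tt0 ht.
exists t => [t'|t' mt' le].
  by apply: le_trans tt0 _; apply: m0.
have : \sum_j (t' 0 j - t 0 j) <= 0.
  by rewrite sumrB subr_le0; apply: ht; rewrite inE /=; apply: mt'.
have d0 j : 0 <= t' 0 j - t 0 j by rewrite subr_ge0.
move=> s0; apply/rowP => j; apply/eqP; rewrite -subr_eq0.
have : \sum_j (t' 0 j - t 0 j) == 0 by rewrite eq_le s0 sumr_ge0.
by rewrite psumr_eq0 // => /allP /(_ j); rewrite mem_index_enum => /(_ isT).
Qed.

End Existence.

(** * The bounds [Lbound] and [Ubound] and their attainment *)

Section Bounds.
Context {R : realType} {n : nat}.
Variables (y : 'rV[R]_n) (lambda : R).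
Hypothesis lambda_ge0 : 0 <= lambda.
Implicit Types (theta : 'rV[R]_n) (tau : R) (i j : 'I_n) (I J : dint n).

(** Reflection turns a strict count into the complement of a weak one; with [uparN], comparisons
    with [upar] become comparisons with [lpar]. *)
Lemma count_ltN I (c : R) :
  (\sum_(j in pts I) ((- y) 0%R j < - c)%R)%N%:R =
  #|pts I|%:R - (\sum_(j in pts I) (y 0%R j <= c)%R)%N%:R :> R.
Proof.
apply/eqP; rewrite -subr_eq opprK -natrD -big_split /= -sum1_card.
by rewrite eqr_nat; apply/eqP/eq_bigr => j _; rewrite
  mxE ltrN2 ltNge; case: (_ <= _).
Qed.

Lemma count_leN I (c : R) :
  (\sum_(j in pts I) ((- y) 0%R j <= - c)%R)%N%:R =
  #|pts I|%:R - (\sum_(j in pts I) (y 0%R j < c)%R)%N%:R :> R.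
Proof.
apply/eqP; rewrite -subr_eq opprK -natrD -big_split /= -sum1_card.
by rewrite eqr_nat; apply/eqP/eq_bigr => j _; rewrite
  mxE lerN2 leNgt; case: (_ < _).
Qed.

Lemma uparN tau I J :
  upar lambda (1 - tau) I J = #|pts I|%:R - lpar lambda tau I J.
Proof. by rewrite /upar /lpar; lra. Qed.

Lemma minimizer_le_Ubound tau theta i : minimizers y lambda tau theta ->
  ((theta 0 i)%:E <= Ubound y lambda tau i)%E.
Proof.
move=> mt; apply: le_bigmin => [|J iJ]; first exact: leey.
have [I [IJ iI hI]] :=
  minimizer_count_le y lambda lambda_ge0 tau theta i J iJ mt.
apply/bigmax_geP; right; exists I; first by rewrite IJ.
(* A count is below the index [floor u + 1] exactly when it is at most [u]. *)
by rewrite order_stat_geP ltzD1 floor_ge_int.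
Qed.

Lemma Lbound_le_minimizer tau theta i : minimizers y lambda tau theta ->
  (Lbound y lambda tau i <= (theta 0 i)%:E)%E.
Proof.
move=> mt; apply: bigmax_le => [|J iJ]; first exact: leNye.
have /minimizersN mt' := mt.
have [I [IJ iI hI]] := minimizer_count_le _ _ lambda_ge0 _ _ i J iJ mt'.
apply/bigmin_leP; right; exists I; first by rewrite IJ.
rewrite order_stat_leP ceil_le_int.
move: hI; rewrite mxE count_ltN uparN; lra.
Qed.

Lemma Ubound_attained tau : 0 < tau < 1 ->
  exists2 theta, minimizers y lambda tau theta &
    forall i, (theta 0 i)%:E = Ubound y lambda tau i.
Proof.
move=> tau01.
have [t mt maxt] := exists_maximal_minimizer y lambda tau lambda_ge0 tau01.
exists t => // i; apply/eqP; rewrite eq_le minimizer_le_Ubound //=.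
have [J [iJ hJ]] :=
  maximal_minimizer_count_gt y lambda lambda_ge0 tau t i mt maxt.
apply/bigmin_leP; right; exists J => //.
apply: bigmax_le => [|I /andP[IJ iI]]; first exact: leNye.
by rewrite order_stat_leP lezD1 floor_lt_int; apply: hJ.
Qed.

End Bounds.

Lemma Lbound_attained {R : realType} {n : nat} (y : 'rV[R]_n) (lambda tau : R) :
  0 <= lambda -> 0 < tau < 1 ->
  exists2 theta, minimizers y lambda tau theta &
    forall i, (theta 0 i)%:E = Lbound y lambda tau i.
Proof.
move=> lambda_ge0 /andP[tau0 tau1].
have tau01' : 0 < 1 - tau < 1 by apply/andP; split; lra.
(* The negative of a maximal minimizer for [- y] and [1 - tau] is a minimal minimizer for [y] and
   [tau]. *)
have [t mt maxt] :=
  exists_maximal_minimizer (- y) lambda (1 - tau) lambda_ge0 tau01'.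
have mt' : minimizers y lambda tau (- t) by apply/minimizersN; rewrite opprK.
exists (- t) => // i; apply/eqP; rewrite eq_le Lbound_le_minimizer // andbT.
have [J [iJ hJ]] := maximal_minimizer_count_gt _ _ lambda_ge0 _ t i mt maxt.
apply/bigmax_geP; right; exists J => //.
apply: le_bigmin => [|I /andP[IJ iI]]; first exact: leey.
rewrite order_stat_geP ceil_gt_int.
have := hJ I IJ iI; rewrite -[t 0 i]opprK count_leN uparN mxE; lra.
Qed.

(** * Pointwise interval, lattice and non-crossing together *)

Theorem theorem1p2 (R : realType) (n : nat) (y : 'rV[R]_n) (lambda : R)
    (hlambda : 0 <= lambda) (tau : R) (htau : 0 < tau < 1) (i : 'I_n) :
  [/\ (exists l u : R,
         [/\ l <= u,
             l%:E = Lbound y lambda tau i,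
             u%:E = Ubound y lambda tau i,
             [set theta 0 i | theta in minimizers y lambda tau] = `[l, u]%classic &
             compact [set theta 0 i | theta in minimizers y lambda tau]]),
      [/\ (forall theta theta' : 'rV[R]_n,
             minimizers y lambda tau theta -> minimizers y lambda tau theta' ->
             minimizers y lambda tau (vmax theta theta') /\
             minimizers y lambda tau (vmin theta theta')),
          (exists2 thetaU : 'rV[R]_n, minimizers y lambda tau thetaU &
             forall j : 'I_n, (thetaU 0 j)%:E = Ubound y lambda tau j) &
          (exists2 thetaL : 'rV[R]_n, minimizers y lambda tau thetaL &
             forall j : 'I_n, (thetaL 0 j)%:E = Lbound y lambda tau j)] &
      (forall tau1 tau2 : R, 0 < tau1 -> tau1 < tau2 -> tau2 < 1 ->
       forall theta1 theta2 : 'rV[R]_n,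
         minimizers y lambda tau1 theta1 -> minimizers y lambda tau2 theta2 ->
         forall j : 'I_n, theta1 0 j <= theta2 0 j)].
Proof.
have [tU mU hU] := Ubound_attained y lambda hlambda tau htau.
have [tL mL hL] := Lbound_attained y lambda tau hlambda htau.
split; last first.
- by move=> t1 t2 _ t12 _ th1 th2; apply: minimizers_noncrossing.
- by split; [apply: minimizers_lattice|exists tU|exists tL].
have tLU : tL 0 i <= tU 0 i.
  by rewrite -lee_fin hU; apply: minimizer_le_Ubound.
have E : [set theta 0 i | theta in minimizers y lambda tau] =
    `[tL 0 i, tU 0 i]%classic.
  apply/seteqP; split=> [_ [t mt <-]|c] /=.
    rewrite in_itv /= -!lee_fin hL hU.
    by rewrite Lbound_le_minimizer // minimizer_le_Ubound.
  rewrite in_itv /= => /andP[c1 c2].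
  (* [c] is a convex combination of the two extreme values; an interval of length zero is treated
     apart, since the weight divides by the length. *)
  have [s s01 sc] : exists2 s : R, 0 <= s <= 1 &
      s * tL 0 i + (1 - s) * tU 0 i = c.
    have [e|lt] := eqVneq (tL 0 i) (tU 0 i); first by exists 0; lra.
    have d0 : 0 < tU 0 i - tL 0 i by rewrite subr_gt0 lt_neqAle lt tLU.
    exists ((tU 0 i - c) / (tU 0 i - tL 0 i)).
      by rewrite divr_ge0 ?ler_pdivrMr //; lra.
    by field; rewrite gt_eqF.
  (* By convexity the same combination of the extreme minimizers is a minimizer, with value [c] at
     [i]. *)
  exists (s *: tL + (1 - s) *: tU); last by rewrite !mxE.
  move=> t;
    apply: (le_trans (objective_convex y lambda hlambda tau s tL tU s01)).
  have /andP[s0 s1] := s01; have s1' : 0 <= 1 - s by rewrite subr_ge0.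
  have := ler_wpM2l s0 (mL t); have := ler_wpM2l s1' (mU t); lra.
exists (tL 0 i), (tU 0 i); split => //.
by rewrite E; apply: segment_compact.
Qed.
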